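(* Let $\mathcal{H}$ be a complex Hilbert space, let $d\geq 1$, and let $\mathbf{T}=(T_1,\ldots,T_d)\in\mathcal{B}(\mathcal{H})^d$. Let $T_k=V_kP$ ($1\le k\le d$) be the polar decomposition of the tuple $\mathbf{T}$, let $\widehat{\mathbf{T}}$ be the spherical Aluthge transform of $\mathbf{T}$, and put $\mathbf{T}_1:=(PV_1,\ldots,PV_d)$. Then $$\omega(\widehat{\mathbf{T}})\leq\frac12\,\omega(\mathbf{T})+\frac12\,\omega(\mathbf{T}_1),$$ where $\omega(\cdot)$ denotes the joint numerical radius of a $d$-tuple.
   Context: $\mathcal{B}(\mathcal{H})$ is the algebra of bounded linear operators on the complex Hilbert space $\mathcal{H}$ with inner product $\langle\cdot\mid\cdot\rangle$. The operators $T_k$ are not assumed to commute. Joint numerical radius: for $\mathbf{T}=(T_1,\ldots,T_d)\in\mathcal{B}(\mathcal{H})^d$, $\omega(\mathbf{T}):=\sup\{(\sum_{k=1}^d|\langle T_kx\mid x\rangle|^2)^{1/2}: x\in\mathcal{H},\ \|x\|=1\}$. Polar decomposition of a tuple: regard $\mathbf{T}$ as the operator $S:\mathcal{H}\to\bigoplus_{i=1}^d\mathcal{H}$, $Sx=(T_1x,\ldots,T_dx)$. Let $S=VP$ be its (canonical) polar decomposition, so $P=(S^*S)^{1/2}=\sqrt{T_1^*T_1+\cdots+T_d^*T_d}$ is a positive operator on $\mathcal{H}$ and $V:\mathcal{H}\to\bigoplus_{i=1}^d\mathcal{H}$, $Vx=(V_1x,\ldots,V_dx)$, is the partial isometry with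 $\mathcal{N}(V)=\bigcap_{i}\mathcal{N}(V_i)=\mathcal{N}(P)=\bigcap_i\mathcal{N}(T_i)$. Thus $T_k=V_kP$ for $1\le k\le d$. Spherical Aluthge transform: $\widehat{\mathbf{T}}=(\widehat{T_1},\ldots,\widehat{T_d}):=(\sqrt{P}V_1\sqrt{P},\ldots,\sqrt{P}V_d\sqrt{P})$. *)

(* Defs.v *)
From HB Require Import structures.
From mathcomp Require Import all_boot all_order all_algebra.
From mathcomp Require Import complex.
From mathcomp Require Import all_classical all_reals topology normedtype.

Set Implicit Arguments.
Unset Strict Implicit.
Unset Printing Implicit Defensive.

Import Order.TTheory GRing.Theory Num.Theory.
Import numFieldNormedType.Exports.

Local Open Scope classical_set_scope.
Local Open Scope ring_scope.

(* A complex Hilbert space is a complete normed module H over R[i] (R the reals)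
   with a form dot : {dot H for conjC} (linear in the first variable,
   conjugate-linear in the second, positive definite) that induces its norm.
   A d-tuple of operators is a family indexed by 'I_d, read as the operator
   x |-> (A_0 x, ..., A_(d-1) x) from H to the Hilbert direct sum H^d. *)

Section OperatorTuples.
Variables (R : realType) (H : completeNormedModType R[i]).
Variable dot : {dot H for @Num.conj R[i]}.

Definition induces_norm : Prop := forall x : H, dot x x = `|x| ^+ 2.

(* Normc.normc is the modulus of a complex number as an element of R. The supremum is
   over the empty set, hence 0, when H is the zero space. *)
Definition joint_numerical_radius (d : nat) (A : 'I_d -> H -> H) : R :=
  sup [set Num.sqrt (\sum_(k < d) Normc.normc (dot (A k x) x) ^+ 2)
      | x in [set x : H | `|x| = 1]].

Definition is_adjoint (A B : H -> H) : Prop :=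
  forall x y, dot (A x) y = dot x (B y).

(* In R[i], 0 <= z means that z is real and nonnegative. *)
Definition positive_operator (A : H -> H) : Prop :=
  forall x, 0 <= dot (A x) x.

(* B = A^(1/2) *)
Definition is_positive_sqrt (A : H -> H) (B : {linear H -> H}) : Prop :=
  [/\ continuous B, positive_operator B & forall x, B (B x) = A x].

(* P = (S^* S)^(1/2), where S x = (T_k x)_k and so S^* S = \sum_k T_k^* T_k. *)
Definition is_modulus (d : nat) (T : 'I_d -> {linear H -> H})
    (P : {linear H -> H}) : Prop :=
  exists2 Tadj : 'I_d -> {linear H -> H},
    forall k, is_adjoint (T k) (Tadj k) &
    is_positive_sqrt (fun x => \sum_(k < d) Tadj k (T k x)) P.

Definition in_kernel (d : nat) (V : 'I_d -> {linear H -> H}) (x : H) : Prop :=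
  forall k, V k x = 0.

(* V : H -> H^d is isometric on the orthogonal complement of its kernel. *)
Definition partial_isometry (d : nat) (V : 'I_d -> {linear H -> H}) : Prop :=
  forall x, (forall y, in_kernel V y -> dot x y = 0) ->
    \sum_(k < d) `|V k x| ^+ 2 = `|x| ^+ 2.

Definition polar_decomposition (d : nat) (T V : 'I_d -> {linear H -> H})
    (P : {linear H -> H}) : Prop :=
  [/\ is_modulus T P,
      forall k, continuous (V k),
      partial_isometry V,
      forall x, in_kernel V x <-> P x = 0 &
      forall k x, T k x = V k (P x)].

(* To be used with Q = P^(1/2). *)
Definition spherical_aluthge (d : nat) (V : 'I_d -> {linear H -> H})
    (Q : {linear H -> H}) (k : 'I_d) : H -> H :=
  Q \o V k \o Q.

End OperatorTuples.

(* Main.v *)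
Require Import Defs.
From mathcomp Require Import all_boot all_order all_algebra.
From mathcomp Require Import complex.
From mathcomp Require Import all_classical all_reals topology normedtype.
From mathcomp Require Import lra ring.
Import Order.TTheory GRing.Theory Num.Theory.
Import numFieldNormedType.Exports.
Local Open Scope ring_scope.

Set Implicit Arguments.
Unset Strict Implicit.
Unset Printing Implicit Defensive.

(** Write Q for the square root of P, M for the joint numerical radius of
    (Q V_k Q)_k, W1 and W2 for those of (V_k P)_k = T and (P V_k)_k, and |x|^2
    for <x, x>.  The inequality W1 + W2 >= 2 M is the first-order condition at
    an (approximate) maximizer, tested in the direction P x.

    For scalars l_k with sum |l_k|^2 <= 1 put
    f(u, v) = Re (sum_k l_k <V_k u, v>), a real-bilinear form.  As Q, being
    positive, is self-adjoint,
      f(Q z, Q z) = Re (sum_k l_k <Q V_k Q z, z>) <= M |z|^2  for every z.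
    If x is a unit vector and (l_k)_k is the conjugate of the vector
    (<Q V_k Q x, x>)_k divided by its norm, then f(Q x, Q x) is the value s at x
    of the expression whose supremum is M.  Since P = Q^2 commutes with Q, with
    y = Q x the inequality at z = x - t P x reads
      s - t (f(y, P y) + f(P y, y)) + t^2 f(P y, P y)
        <= M (1 - 2 t |y|^2 + t^2 |P x|^2).
    The linear terms are exactly what the right-hand side of the theorem
    controls: f(P y, y) <= W1 |y|^2, and f(y, P y) <= W2 |y|^2 because P can be
    moved across the inner product.  Choosing x with s >= M - t^2 leaves
      t (2 M - W1 - W2) |y|^2 <= t^2 (1 + 2 M C),  where |P z|^2 <= C |z|^2.
    Finally |y| cannot degenerate as t tends to 0, since s = f(y, y) <= N |y|^2
    with N the joint numerical radius of V; this is [near_max_estimate].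
    Letting t tend to 0 excludes 2 M > W1 + W2. *)

(** * Complex numbers through their real parts *)

Section RealParts.
Variable R : realType.
Implicit Types z w : R[i].

Lemma ReD z w : complex.Re (z + w) = complex.Re z + complex.Re w.
Proof. by case: z w => [a b] [c d]. Qed.

Lemma ReN z : complex.Re (- z) = - complex.Re z.
Proof. by case: z. Qed.

Lemma ReZ (r : R) z : complex.Re (r%:C%C * z) = r * complex.Re z.
Proof. by case: z => [a b] /=; rewrite mul0r subr0. Qed.

Lemma Re_conj z : complex.Re (Num.conj z) = complex.Re z.
Proof. by case: z. Qed.

Lemma normc_sqr z : Normc.normc z ^+ 2 = complex.Re z ^+ 2 + complex.Im z ^+ 2.
Proof. by case: z => a b; rewrite /= sqr_sqrtr// addr_ge0// sqr_ge0. Qed.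

(** Cauchy-Schwarz in C^d, from 2 Re (s p q) <= s^2 |p|^2 + |q|^2 summed over
    the coordinates. *)
Lemma Re_sum_le d (l a : 'I_d -> R[i]) (s : R) : 0 <= s ->
  \sum_k Normc.normc (l k) ^+ 2 <= 1 ->
  \sum_k Normc.normc (a k) ^+ 2 <= s ^+ 2 ->
  \sum_k complex.Re (l k * a k) <= s.
Proof.
move=> s0 l1 as_.
have [s_eq0|s_neq0] := eqVneq s 0.
  rewrite s_eq0 big1// => k _.
  have : Normc.normc (a k) ^+ 2 <= 0.
    apply: le_trans (_ : \sum_k Normc.normc (a k) ^+ 2 <= 0).
      by rewrite (bigD1 k)//= lerDl sumr_ge0// => i _; exact: sqr_ge0.
    by apply: le_trans as_ _; rewrite s_eq0 expr0n.
  rewrite le_eqVlt ltNge sqr_ge0 orbF sqrf_eq0 => /eqP/Normc.eq0_normc->.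
  by rewrite mulr0.
have {s_neq0} s_gt0 : 0 < s by rewrite lt_def s_neq0.
rewrite -(ler_pM2l s_gt0).
suff : 2 * (s * \sum_k complex.Re (l k * a k)) <=
    s ^+ 2 * \sum_k Normc.normc (l k) ^+ 2 + \sum_k Normc.normc (a k) ^+ 2.
  move=> *; nra.
rewrite !mulr_sumr -big_split /=; apply: ler_sum => k _.
rewrite !normc_sqr; case: (l k) (a k) => [p q] [u v] /=.
have := sqr_ge0 (s * p - u); have := sqr_ge0 (s * q + v); nra.
Qed.

(** Equality holds in [Re_sum_le] for the conjugate of the vector a divided by
    its norm. *)
Lemma attaining_coefficients d (a : 'I_d -> R[i]) (s : R) : 0 < s ->
  \sum_k Normc.normc (a k) ^+ 2 = s ^+ 2 ->
  exists2 l : 'I_d -> R[i], \sum_k Normc.normc (l k) ^+ 2 <= 1 &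
    \sum_k complex.Re (l k * a k) = s.
Proof.
move=> s0 as_; exists (fun k => (s^-1)%:C%C * Num.conj (a k)).
  under eq_bigr => k _.
    rewrite Normc.normcM exprMn.
    have -> : Normc.normc (s^-1)%:C%C ^+ 2 = (s ^+ 2)^-1 :> R.
      by rewrite normc_sqr /= expr0n addr0 exprVn.
    have -> : Normc.normc (Num.conj (a k)) ^+ 2 = Normc.normc (a k) ^+ 2.
      by rewrite !normc_sqr; case: (a k) => ? ? /=; rewrite sqrrN.
    over.
  by rewrite -mulr_sumr as_ mulVf// expf_neq0// gt_eqF.
under eq_bigr => k _.
  have -> : complex.Re ((s^-1)%:C%C * Num.conj (a k) * a k) =
      s^-1 * Normc.normc (a k) ^+ 2.
    by rewrite normc_sqr; case: (a k) => ? ? /=; ring.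
  over.
by rewrite -mulr_sumr as_ expr2 mulKf// gt_eqF.
Qed.

End RealParts.

(** * The real quadratic form of the inner product *)

Section Form.
Variables (R : realType) (H : completeNormedModType R[i]).
Variable dot : {dot H for @Num.conj R[i]}.
Implicit Types (x y : H) (Q : {linear H -> H}).

Lemma dotC x y : dot x y = Num.conj (dot y x).
Proof. by rewrite hermC expr0 mul1r. Qed.

Lemma dotDl x y z : dot (x + y) z = dot x z + dot y z.
Proof. exact: linearDl. Qed.

Lemma dotDr x y z : dot x (y + z) = dot x y + dot x z.
Proof. exact: linearDr. Qed.

Lemma dotZl a x y : dot (a *: x) y = a * dot x y.
Proof. exact: linearZl_LR. Qed.

Lemma dotZr a x y : dot x (a *: y) = Num.conj a * dot x y.
Proof. exact: linearZr_LR. Qed.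

(** Polarization: <Q u, u> is real for u = x + y and for u = x + i y, which
    determines both parts of <Q x, y> from <Q y, x>. *)
Lemma positive_selfadjoint Q : positive_operator dot Q -> is_adjoint dot Q Q.
Proof.
move=> Qpos x y; rewrite [RHS]dotC.
have ImQ u : complex.Im (dot (Q u) u) = 0 by apply: ger0_Im.
have := ImQ (x + y); have := ImQ (x + 'i%C *: y); have := ImQ x; have := ImQ y.
rewrite ![Q (_ + _)]linearD ![Q (_ *: _)]linearZ /= !dotDl !dotDr !dotZl !dotZr.
case: (dot (Q x) x) (dot (Q x) y) (dot (Q y) x) (dot (Q y) y) =>
  [a a'] [b b'] [c c'] [e e'] /= -> -> imi im1; congr (_ +i* _)%C; lra.
Qed.

(** The squared norm as an element of R rather than of R[i], so that all
    estimates below take place in an ordered field. *)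
Definition sqn x : R := complex.Re (dot x x).

Lemma sqnE x : dot x x = (sqn x)%:C%C.
Proof.
have := dotC x x; rewrite /sqn; case: (dot x x) => a b [] b0.
by congr (_ +i* _)%C; lra.
Qed.

Lemma sqn_ge0 x : 0 <= sqn x.
Proof.
have [->|x0] := eqVneq x 0; first by rewrite /sqn linear0l.
by have := ltW (neq0_dnorm_gt0 (s:=dot) _ x0); rewrite sqnE ler0c.
Qed.

Lemma sqnD x y : sqn (x + y) = sqn x + 2 * complex.Re (dot x y) + sqn y.
Proof.
rewrite /sqn dotDl !dotDr !ReD (dotC y x) Re_conj; ring.
Qed.

Lemma sqnZ (r : R) x : sqn (r%:C%C *: x) = r ^+ 2 * sqn x.
Proof.
rewrite /sqn dotZl dotZr.
have -> : Num.conj (r%:C%C) = r%:C%C :> R[i].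
  by apply/eqP; rewrite eq_complex /= oppr0 !eqxx.
by rewrite !ReZ mulrA.
Qed.

(** A weak Cauchy-Schwarz inequality, used only to see that the suprema are
    finite.  It bounds twice the real part by expanding |u + y|^2 and |u - y|^2,
    and twice the imaginary part by the same bound at u = i x. *)
Lemma normc_dot_le x y : Normc.normc (dot x y) ^+ 2 <= (sqn x + sqn y) ^+ 2.
Proof.
have Rele u : (2 * complex.Re (dot u y)) ^+ 2 <= (sqn u + sqn y) ^+ 2.
  have := sqn_ge0 (u + y); have := sqn_ge0 (u + (-1)%:C%C *: y).
  rewrite !sqnD sqnZ dotZr; case: (dot u y) => a b /=.
  have := sqn_ge0 u; have := sqn_ge0 y => *.
  rewrite -subr_ge0 subr_sqr mulr_ge0//; lra.
have i2 : sqn ('i%C *: x) = sqn x.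
  rewrite /sqn dotZl dotZr; case: (dot x x) => a b /=; lra.
have := Rele x; have := Rele ('i%C *: x); rewrite i2 dotZl normc_sqr.
case: (dot x y) => a b /=; nra.
Qed.

(** * Bounded operators and the joint numerical radius *)

Section Bounded.
Hypothesis Hdot : induces_norm dot.

Lemma sqn_unit x : `|x| = 1 <-> sqn x = 1.
Proof.
split=> [x1|x1]; have := Hdot x; rewrite sqnE x1; first by rewrite expr1n => -[].
by move=> /esym/eqP; rewrite sqrp_eq1 // => /eqP.
Qed.

Definition sqn_bounded (A : H -> H) :=
  exists2 C : R, 0 <= C & forall x, sqn (A x) <= C * sqn x.

Lemma continuous_sqn_bounded (A : {linear H -> H}) :
  continuous A -> sqn_bounded A.
Proof.
move=> /linear_bounded_continuous/linear_boundedP [M [Mreal bM]].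
have := bM (M + 1); rewrite ltrDl ltr01 => /(_ isT) {}bM.
pose C := complex.Re (M + 1).
have CE : M + 1 = C%:C%C by rewrite RRe_real// realD// real1.
exists (C ^+ 2); first exact: sqr_ge0.
move=> x; rewrite -lecR rmorphM/= rmorphXn/= -!sqnE !Hdot -exprMn -CE.
by rewrite lerXn2r ?nnegrE//; apply: le_trans (bM x).
Qed.

Lemma sqn_bounded_comp (A B : H -> H) :
  sqn_bounded A -> sqn_bounded B -> sqn_bounded (A \o B).
Proof.
move=> [a a0 Aa] [b b0 Bb]; exists (a * b); first exact: mulr_ge0.
by move=> x; apply: le_trans (Aa _) _; rewrite -mulrA ler_wpM2l.
Qed.

Variable d : nat.
Implicit Types A : 'I_d -> {linear H -> H}.

Lemma numerical_values_ubound A : (forall k, sqn_bounded (A k)) ->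
  has_ubound [set Num.sqrt (\sum_(k < d) Normc.normc (dot (A k x) x) ^+ 2)
      | x in [set x : H | `|x| = 1]]%classic.
Proof.
move=> bA.
have /boolp.choice [C CA] k : exists C : R, forall x, sqn (A k x) <= C * sqn x.
  by have [C] := bA k; exists C.
exists (Num.sqrt (\sum_k (C k + 1) ^+ 2)) => _ [x /sqn_unit x1 <-].
rewrite ler_wsqrtr// ler_sum// => k _; apply: le_trans (normc_dot_le _ _) _.
have := CA k x; have := sqn_ge0 (A k x); rewrite x1 => *; nra.
Qed.

(** On an empty or unbounded set the supremum is 0 by convention. *)
Lemma jnr_ge0 (A : 'I_d -> H -> H) : 0 <= joint_numerical_radius dot A.
Proof.
rewrite /joint_numerical_radius; set S := (X in sup X).
have [[[r Sr] Sub]|noS] := pselect (has_sup S); last by rewrite sup_out.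
by apply: le_trans (ub_le_sup Sub Sr); case: Sr => x _ <-; exact: sqrtr_ge0.
Qed.

(** Both sides are homogeneous in x, so this is the defining bound of the
    supremum at the unit vector proportional to x. *)
Lemma jnr_bound A x : (forall k, sqn_bounded (A k)) ->
  \sum_(k < d) Normc.normc (dot (A k x) x) ^+ 2 <=
    (joint_numerical_radius dot A * sqn x) ^+ 2.
Proof.
move=> bA; have := sqn_ge0 x; rewrite le_eqVlt => /predU1P[/esym x0|x0].
  rewrite x0 mulr0 expr0n /= big1// => k _; have [C _ CA] := bA k.
  apply/le_anti; rewrite sqr_ge0 andbT.
  apply: le_trans (normc_dot_le _ _) _; have := CA x; have := sqn_ge0 (A k x).
  rewrite x0 mulr0 addr0 => *; nra.
set r := (Num.sqrt (sqn x))^-1.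
have r2 : r ^+ 2 * sqn x = 1.
  by rewrite exprVn sqr_sqrtr ?sqn_ge0 // mulVf// gt_eqF.
have u1 : `|r%:C%C *: x| = 1 by apply/sqn_unit; rewrite sqnZ.
have := ub_le_sup (numerical_values_ubound bA).
move=> /(_ _ (imageP _ u1)); rewrite -ler_sqr ?nnegrE ?sqrtr_ge0 ?jnr_ge0//.
rewrite sqr_sqrtr; last by apply: sumr_ge0 => k _; exact: sqr_ge0.
have scale k : Normc.normc (dot (A k (r%:C%C *: x)) (r%:C%C *: x)) ^+ 2 =
    (r ^+ 2) ^+ 2 * Normc.normc (dot (A k x) x) ^+ 2.
  rewrite [A k _]linearZ /= dotZl dotZr !normc_sqr.
  by case: (dot (A k x) x) => a b /=; ring.
rewrite (eq_bigr _ (fun k _ => scale k)) -mulr_sumr => le_u.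
have := ler_wpM2r (sqr_ge0 (sqn x)) le_u.
by rewrite mulrAC -exprMn r2 expr1n mul1r -exprMn.
Qed.

(** This linearizes the joint numerical radius: by duality of C^d with itself it
    dominates the numerical radius of every combination of the A_k with
    coefficients in the unit ball. *)
Lemma Re_jnr_le A (l : 'I_d -> R[i]) x : (forall k, sqn_bounded (A k)) ->
  \sum_k Normc.normc (l k) ^+ 2 <= 1 ->
  \sum_k complex.Re (l k * dot (A k x) x) <=
    joint_numerical_radius dot A * sqn x.
Proof.
move=> bA l1; apply: Re_sum_le l1 (jnr_bound x bA).
by rewrite mulr_ge0 ?jnr_ge0 ?sqn_ge0.
Qed.

End Bounded.

(** * The real-bilinear form of a combination of operators *)

Section Pairing.
Variables (d : nat) (V : 'I_d -> {linear H -> H}) (l : 'I_d -> R[i]).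

Definition pairing x y : R := \sum_k complex.Re (l k * dot (V k x) y).

Lemma pairing_perturb (t : R) x y :
  pairing (x + t%:C%C *: y) (x + t%:C%C *: y) =
  pairing x x + t * (pairing x y + pairing y x) + t ^+ 2 * pairing y y.
Proof.
rewrite /pairing mulrDr !mulr_sumr -!big_split /=; apply: eq_bigr => k _.
rewrite [V k _]linearD [V k (_ *: _)]linearZ /= dotDl !dotDr !dotZl !dotZr.
case: (l k) (dot (V k x) x) (dot (V k x) y) (dot (V k y) x) (dot (V k y) y).
by move=> ? ? [? ?] [? ?] [? ?] [? ?] /=; ring.
Qed.

End Pairing.

Lemma sqn_selfadjoint_sqrt (P Q : {linear H -> H}) x :
  is_adjoint dot Q Q -> (forall x, Q (Q x) = P x) ->
  complex.Re (dot x (P x)) = sqn (Q x).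
Proof. by move=> Qadj QQ; rewrite -QQ -Qadj. Qed.

End Form.

(** * The first-order condition at a near-maximizer *)

(** Here s is the value at the unit vector x of the expression whose supremum
    is M, and t is both the step length in the direction - P x and the square
    root of the allowed defect of x from being a maximizer; with this coupling
    all error terms are of order t^2. *)
Lemma near_max_estimate (R : realType) (H : completeNormedModType R[i])
    (dot : {dot H for @Num.conj R[i]}) (Hdot : induces_norm dot) (d : nat)
    (V : 'I_d -> {linear H -> H}) (P Q : {linear H -> H})
    (Vbd : forall k, sqn_bounded dot (V k)) (Qbd : sqn_bounded dot Q)
    (Qadj : is_adjoint dot Q Q) (QQ : forall x, Q (Q x) = P x) (C : R)
    (PC : forall x, sqn dot (P x) <= C * sqn dot x) (t : R) (x : H) (s : R) :
  let M := joint_numerical_radius dot (fun k => Q \o V k \o Q) in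
  let W1 := joint_numerical_radius dot (fun k => V k \o P) in
  let W2 := joint_numerical_radius dot (fun k => P \o V k) in
  let N := joint_numerical_radius dot (fun k => V k) in
  W1 + W2 <= 2 * M -> sqn dot x = 1 -> 0 <= t -> 0 < s -> M - t ^+ 2 <= s ->
  \sum_k Normc.normc (dot (Q (V k (Q x))) x) ^+ 2 = s ^+ 2 ->
  t * (2 * M - W1 - W2) * s <= N * (t ^+ 2 * (1 + 2 * M * C)).
Proof.
move=> M W1 W2 N WM x1 t0 s0 sM as_.
have [l l1 ls] := attaining_coefficients s0 as_.
pose f := pairing dot V l; set y := Q x.
have QP z : Q (P z) = P (Q z) by rewrite -!QQ.
have Padj : is_adjoint dot P P by move=> u v; rewrite -!QQ !Qadj.
have Pbd : sqn_bounded dot P.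
  have [c c0 cQ] := sqn_bounded_comp Qbd Qbd.
  by exists c => // z; rewrite -QQ; exact: cQ.
have Abd k : sqn_bounded dot (Q \o V k \o Q).
  by do 2?[apply: sqn_bounded_comp => //].
have fM z : f (Q z) (Q z) <= M * sqn dot z.
  have -> : f (Q z) (Q z) = \sum_k complex.Re (l k * dot ((Q \o V k \o Q) z) z).
    by apply: eq_bigr => k _; rewrite /= Qadj.
  exact: (@Re_jnr_le _ _ _ Hdot _ (fun k => Q \o V k \o Q) _ _).
have fMN z : - f (Q z) (Q z) <= M * sqn dot z.
  have -> : - f (Q z) (Q z) =
      \sum_k complex.Re (- l k * dot ((Q \o V k \o Q) z) z).
    by rewrite -sumrN; apply: eq_bigr => k _; rewrite /= Qadj mulNr ReN.
  apply: (@Re_jnr_le _ _ _ Hdot _ (fun k => Q \o V k \o Q) _ _) => //.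
  by under eq_bigr => k _ do rewrite normcN.
have fW1 : f (P y) y <= W1 * sqn dot y.
  apply: (@Re_jnr_le _ _ _ Hdot _ (fun k => V k \o P) _ y _ l1) => k.
  exact: sqn_bounded_comp.
have fW2 : f y (P y) <= W2 * sqn dot y.
  have -> : f y (P y) = \sum_k complex.Re (l k * dot ((P \o V k) y) y).
    by apply: eq_bigr => k _; rewrite /= Padj.
  apply: (@Re_jnr_le _ _ _ Hdot _ (fun k => P \o V k) _ _) => // k.
  exact: sqn_bounded_comp.
have fN : s <= N * sqn dot y.
  rewrite -ls; under eq_bigr => k _ do rewrite Qadj.
  exact: (@Re_jnr_le _ _ _ Hdot _ V).
have fs : f y y = s by rewrite -ls; apply: eq_bigr => k _; rewrite Qadj.
have M0 : 0 <= M by exact: jnr_ge0.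
have N0 : 0 <= N by exact: jnr_ge0.
(* the variation of the quadratic form at x in the direction - P x *)
have := fM (x + (- t)%:C%C *: P x).
rewrite sqnD sqnZ dotZr [Q _]linearD [Q (_ *: _)]linearZ /= QP -/y.
rewrite /f pairing_perturb -/f -/(f y y) fs.
have -> : complex.Re (Num.conj (- t)%:C%C * dot x (P x)) = - t * sqn dot y.
  rewrite -(sqn_selfadjoint_sqrt _ Qadj QQ); case: (dot x (P x)) => a b /=; ring.
have := fMN (P x); rewrite QP -/y => fMNP.
have MPC := ler_wpM2l M0 (PC x); rewrite x1 mulr1 in MPC * => fMx.
have t2 : 0 <= t ^+ 2 by exact: sqr_ge0.
have first_order :
    t * (2 * M - W1 - W2) * sqn dot y <= t ^+ 2 * (1 + 2 * M * C).
  have := ler_wpM2l t0 fW1; have := ler_wpM2l t0 fW2.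
  have := ler_wpM2l t2 fMNP; have := ler_wpM2l t2 MPC; lra.
(* |y|^2 is traded for its lower bound s / N, without dividing by N *)
have tW0 : 0 <= t * (2 * M - W1 - W2) by apply: mulr_ge0 => //; lra.
by have := ler_wpM2l tW0 fN; have := ler_wpM2l N0 first_order; lra.
Qed.

Theorem theorem2p2 (R : realType) (H : completeNormedModType R[i])
    (dot : {dot H for @Num.conj R[i]}) (Hdot : induces_norm dot)
    (d : nat) (d_ge1 : (1 <= d)%N)
    (T : 'I_d -> {linear H -> H}) (T_bounded : forall k, continuous (T k))
    (V : 'I_d -> {linear H -> H}) (P : {linear H -> H})
    (TVP : polar_decomposition dot T V P)
    (sqrtP : {linear H -> H}) (sqrtPE : is_positive_sqrt dot P sqrtP) :
  joint_numerical_radius dot (spherical_aluthge V sqrtP) <=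
    2^-1 * joint_numerical_radius dot (fun k => T k) +
    2^-1 * joint_numerical_radius dot (fun k => P \o V k).
Proof.
case: TVP sqrtPE => _ Vcont _ _ TE [Qcont Qpos QQ].
have -> : (fun k => T k : H -> H) = (fun k => V k \o P).
  by apply/boolp.funext => k; apply/boolp.funext => x; exact: TE.
pose Q := sqrtP.
have Qbd : sqn_bounded dot Q by exact: continuous_sqn_bounded.
have Vbd k : sqn_bounded dot (V k) by exact: continuous_sqn_bounded.
have Qadj : is_adjoint dot Q Q by exact: positive_selfadjoint.
have [C C0 QC] := sqn_bounded_comp Qbd Qbd.
have PC x : sqn dot (P x) <= C * sqn dot x by rewrite -QQ; exact: QC.
set W1 := joint_numerical_radius dot (fun k => V k \o P).
set W2 := joint_numerical_radius dot (fun k => P \o V k).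
set M := joint_numerical_radius dot _.
have W1_ge0 : 0 <= W1 by exact: jnr_ge0.
have W2_ge0 : 0 <= W2 by exact: jnr_ge0.
pose N := joint_numerical_radius dot (fun k => V k).
have N_ge0 : 0 <= N by exact: jnr_ge0.
have [|M_gt] := leP M (2^-1 * W1 + 2^-1 * W2); first by [].
have M_gt0 : 0 < M by lra.
pose K := 2 * M - W1 - W2; have K_gt0 : 0 < K by rewrite /K; lra.
pose D := N * (1 + 2 * M * C).
have D_ge0 : 0 <= D by rewrite mulr_ge0// addr_ge0// !mulr_ge0// ltW.
have KM_gt0 : 0 < K * M by exact: mulr_gt0.
have E_gt0 : 0 < D + 2 * K + K * M by lra.
(* any t with t <= 1, t^2 < M and t (D + K) < K M contradicts the estimate at a
   vector x with defect at most t^2; this choice meets the three conditions *)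
pose t := K * M / (D + 2 * K + K * M).
have tE : t * (D + 2 * K + K * M) = K * M by rewrite divfK// gt_eqF.
have t_gt0 : 0 < t by exact: divr_gt0.
have t_lt1 : t < 1 by rewrite ltr_pdivrMr//; lra.
have tM : 2 * t <= M.
  rewrite -(ler_pM2l K_gt0) -tE.
  have := mulr_ge0 (ltW t_gt0) D_ge0; have := mulr_gt0 t_gt0 KM_gt0; lra.
have t2 : t ^+ 2 <= t by rewrite expr2 ler_piMr// ltW.
(* M > 0 rules out the degenerate values of the supremum *)
have supM : has_sup [set Num.sqrt
    (\sum_(k < d) Normc.normc (dot (spherical_aluthge V Q k x) x) ^+ 2)
    | x in [set x : H | `|x| = 1]]%classic.
  apply: contrapT => /sup_out M_eq0.
  by move: M_gt0; rewrite /M [X in _ < X]M_eq0 ltxx.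
have [_ [x /= x1 <-] sM] := sup_adherent (exprn_gt0 2 t_gt0) supM.
move: sM; rewrite -/(joint_numerical_radius dot (spherical_aluthge V Q)) -/M.
set s := Num.sqrt _ => sM.
have sq_s : \sum_k Normc.normc (dot (Q (V k (Q x))) x) ^+ 2 = s ^+ 2.
  by rewrite sqr_sqrtr// sumr_ge0// => k _; exact: sqr_ge0.
have s_gt0 : 0 < s by lra.
have WM : W1 + W2 <= 2 * M by lra.
have := near_max_estimate Hdot Vbd Qbd Qadj QQ PC WM
  ((sqn_unit Hdot x).1 x1) (ltW t_gt0) s_gt0 (ltW sM) sq_s.
have -> : joint_numerical_radius dot (fun k => V k) * (t ^+ 2 * (1 + 2 * M * C))
    = t * (t * D) by rewrite /D -/N; ring.
rewrite -/K -mulrA ler_pM2l// => KsD.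
have Kt_gt0 := mulr_gt0 K_gt0 t_gt0; have tKM_gt0 := mulr_gt0 t_gt0 KM_gt0.
have Kt2 := ler_wpM2l (ltW K_gt0) t2.
have KMs : K * M <= K * s + K * t ^+ 2 by rewrite -mulrDr ler_pM2l//; lra.
by exfalso; move: tE KsD Kt_gt0 tKM_gt0 Kt2 KMs; lra.
Qed.
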